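(* Let $\alpha,\beta>0$ and consider the asymmetric annihilation process on $L$ sites. For $1\le m<L$, the stationary density at site $m$ is $$\langle\eta_m\rangle=\frac{\alpha}{2^{2(m-1)}(1+2\alpha)^m}\sum_{j=0}^{m-1}\binom{m-1+j}{j}(1+2\alpha)^j\,2^{m-1-j},$$ and, as $m\to\infty$ (with $L>m$; the value does not depend on $L$), $$\langle\eta_m\rangle\sim\frac1{2\sqrt{\pi m}},$$ independently of $\alpha$.
   Context: The model: a continuous-time Markov chain on configurations $\eta=(\eta_1,\dots,\eta_L)\in\{0,1\}^L$ ($\eta_i=1$ if site $i$ is occupied, $0$ if empty), with parameters $\alpha,\beta>0$ and the following transitions. Bulk: for each pair of neighbouring sites $(i,i+1)$, $1\le i\le L-1$, $10\to 01$ with rate $1$ and $11\to 00$ with rate $1$. Left boundary: at site $1$, $0\to 1$ with rate $\alpha$ and $1\to 0$ with rate $\alpha$. Right boundary: at site $L$, $1\to0$ with rate $\beta$. The bracket $\langle\cdot\rangle$ denotes expectation with respect to the unique stationary distribution of this chain. The symbol $\sim$ means that the ratio of the two sides tends to $1$. *)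

(* Defs.v *)
From HB Require Import structures.
From mathcomp Require Import all_boot all_order all_algebra.
From mathcomp Require Import all_classical all_reals all_analysis.
Set Implicit Arguments.
Unset Strict Implicit.
Unset Printing Implicit Defensive.
Import Order.TTheory GRing.Theory Num.Theory.
Import numFieldNormedType.Exports.
Local Open Scope classical_set_scope.
Local Open Scope ring_scope.

(* The site labelled k (1 <= k <= L) is the ordinal of value
   k.-1. *)
Definition config (L : nat) := {ffun 'I_L -> bool}.

Definition setsite (L : nat) (eta : config L) (i : 'I_L) (b : bool) :
    config L :=
  [ffun k => if k == i then b else eta k].

Definition bulk_rate (R : realType) (L : nat) (eta eta' : config L) : R :=
  \sum_(i < L) \sum_(j < L | j == i.+1 :> nat)
    ([&& eta i, ~~ eta j
       & eta' == setsite (setsite eta i false) j true]%:R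
     + [&& eta i, eta j
          & eta' == setsite (setsite eta i false) j false]%:R).

Definition left_rate (R : realType) (alpha : R) (L : nat)
    (eta eta' : config L) : R :=
  \sum_(i < L | i == 0 :> nat)
    alpha * (eta' == setsite eta i (~~ eta i))%:R.

Definition right_rate (R : realType) (beta : R) (L : nat)
    (eta eta' : config L) : R :=
  \sum_(i < L | i.+1 == L)
    beta * (eta i && (eta' == setsite eta i false))%:R.

Definition rate (R : realType) (alpha beta : R) (L : nat)
    (eta eta' : config L) : R :=
  bulk_rate R eta eta' + left_rate alpha eta eta' + right_rate beta eta eta'.

Definition stationary (R : realType) (alpha beta : R) (L : nat)
    (p : {ffun config L -> R}) : Prop :=
  [/\ forall eta, 0 <= p eta,
      \sum_(eta : config L) p eta = 1
    & forall eta, \sum_(eta' : config L) p eta' * rate alpha beta eta' eta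
                = p eta * \sum_(eta' : config L) rate alpha beta eta eta'].

(* The default value is only taken if there is no stationary distribution. *)
Definition stationary_law (R : realType) (alpha beta : R) (L : nat) :
    {ffun config L -> R} :=
  xget [ffun=> 0] [set p | stationary alpha beta p].

Definition bracket (R : realType) (alpha beta : R) (L : nat)
    (f : config L -> R) : R :=
  \sum_(eta : config L) stationary_law alpha beta L eta * f eta.

(* The occupation number of the site labelled m; it is 0 when m is not a label
   of one of the L sites. *)
Definition occ (R : realType) (L : nat) (m : nat) (eta : config L) : R :=
  \sum_(i < L | i.+1 == m) (eta i)%:R.

(* Main.v *)
Require Import Defs.
From HB Require Import structures.
From mathcomp Require Import all_boot all_order all_algebra.
From mathcomp Require Import all_classical all_reals all_analysis.
From mathcomp Require Import ring lra zify.
Set Implicit Arguments.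
Unset Strict Implicit.
Unset Printing Implicit Defensive.
Import Order.TTheory GRing.Theory Num.Theory.
Import numFieldNormedType.Exports.
Local Open Scope classical_set_scope.
Local Open Scope ring_scope.

(** For a set [S] of sites let [chi_S] be the product of the spins
    [(-1) ^+ eta_i], [i] in [S]. A particle leaving site [i] flips the spins
    [i] and [i.+1], so stationarity expresses the mean of [chi_S] by the means
    of [chi_S'], where [S'] is [S] with one endpoint of one of its blocks moved
    to the left. This recursion terminates, so the total mass determines a
    stationary law; it exists because the generator is singular, and it is
    nonnegative because the absolute value of a stationary measure is again
    stationary.

    For the mean [E x y] over the block of sites [x+1..y] the recursion reads
    [2 E(x+1,y+1) = E(x,y+1) + E(x+1,y)], [E x x = 1] and [E 0 y = q ^ y] with
    [q = 1 / (1 + 2 alpha)], and reflection solves it by binomial tails. Hence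
    the density at site [p+1] is half the average of
    [C(2p-i,p) / 2 ^ (2p-i)] for the geometric weights [(1 - q) q ^ i], [i <= p];
    the [i]-th value is within a factor [1 - i ^ 2 / p] of the central one, which
    Wallis' product compares with [1 / sqrt (pi (p+1))]. *)

(** * The annihilation process and its dual *)

Section Chain.
Variables (R : realType) (alpha beta : R) (L : nat).
Implicit Types (eta : config L) (s : nat -> bool).

(** Leaving the system counts as a jump across a bond from the last site to a phantom site; there
    [hop] flips the last site only, its second flip falling outside ['I_L]. *)
Definition bond_rate (i : nat) : R := if i.+1 == L then beta else 1.

Definition hop (i : nat) eta : config L :=
  [ffun k : 'I_L => eta k (+) ((k == i :> nat) || (k == i.+1 :> nat))].

Definition flip (i : 'I_L) eta : config L := setsite eta i (~~ eta i).

Lemma hop_vacant (i j : 'I_L) eta : j = i.+1 :> nat -> eta i -> ~~ eta j ->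
  setsite (setsite eta i false) j true = hop i eta.
Proof.
move=> ji ei /negbTE ej; apply/ffunP => k; rewrite !ffunE -!val_eqE /= ji.
have [kj|kj] := eqVneq (k : nat) i.+1.
  by rewrite (_ : k = j) ?ej ?orbT //; apply: val_inj; rewrite /= kj.
have [ki|ki] := eqVneq (k : nat) i; last by rewrite /= addbF.
by rewrite (val_inj ki) ei.
Qed.

Lemma hop_occupied (i j : 'I_L) eta : j = i.+1 :> nat -> eta i -> eta j ->
  setsite (setsite eta i false) j false = hop i eta.
Proof.
move=> ji ei ej; apply/ffunP => k; rewrite !ffunE -!val_eqE /= ji.
have [kj|kj] := eqVneq (k : nat) i.+1.
  by rewrite (_ : k = j) ?ej ?orbT //; apply: val_inj; rewrite /= kj.
have [ki|ki] := eqVneq (k : nat) i; last by rewrite /= addbF.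
by rewrite (val_inj ki) ei.
Qed.

Lemma hop_last (i : 'I_L) eta : i.+1 = L -> eta i ->
  setsite eta i false = hop i eta.
Proof.
move=> iL ei; apply/ffunP => k; rewrite !ffunE -!val_eqE /=.
have [ki|ki] := eqVneq (k : nat) i; first by rewrite (val_inj ki) ei.
by rewrite iL (ltn_eqF (ltn_ord k)) addbF.
Qed.

(* Whether the right neighbour is occupied or not, a move across a bond empties
   its left end and flips its right end. *)
Lemma rateE eta eta' : rate alpha beta eta eta' =
  \sum_(i < L) bond_rate i * (eta i && (eta' == hop i eta))%:R
  + alpha * \sum_(i < L | i == 0 :> nat) (eta' == flip i eta)%:R.
Proof.
rewrite /rate /left_rate -mulr_sumr addrAC; congr (_ + _).
rewrite /bulk_rate /right_rate [X in _ + X]big_mkcond -big_split /=.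
apply: eq_bigr => i _; rewrite /bond_rate.
case: eqP => [iL|iL].
  rewrite big_pred0 => [|j]; last by rewrite iL (ltn_eqF (ltn_ord j)).
  rewrite add0r; congr (_ * _%:R).
  by case ei: (eta i) => //=; rewrite (@hop_last i).
have iL' : (i.+1 < L)%N by have := ltn_ord i; lia.
rewrite (big_pred1 (Ordinal iL')) => //.
rewrite addr0 mul1r.
case ei: (eta i) => /=; last by rewrite addr0.
case ej: (eta (Ordinal iL')) => /=.
  by rewrite add0r (@hop_occupied i).
by rewrite addr0 (@hop_vacant i) ?ej.
Qed.

Lemma sum_delta (f : config L -> R) eta0 :
  \sum_eta (eta == eta0)%:R * f eta = f eta0.
Proof.
rewrite (bigD1 eta0) //= eqxx mul1r big1 ?addr0 // => eta /negbTE ->.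
by rewrite mul0r.
Qed.

Lemma sum_rate (f : config L -> R) eta :
  \sum_eta' rate alpha beta eta eta' * f eta' =
  \sum_(i < L) bond_rate i * (eta i)%:R * f (hop i eta)
  + alpha * \sum_(i < L | i == 0 :> nat) f (flip i eta).
Proof.
under eq_bigr do rewrite rateE mulrDl -mulrA !mulr_suml.
rewrite big_split /= -mulr_sumr exchange_big /=; congr (_ + _ * _).
  apply: eq_bigr => i _.
  rewrite -(sum_delta f (hop i eta)) mulr_sumr; apply: eq_bigr => eta' _.
  by case: (eta i) => /=; rewrite ?mulr1 ?mulr0 ?mul0r // mulrA.
by rewrite exchange_big /=; apply: eq_bigr => i _; rewrite sum_delta.
Qed.

Definition balanced (d : config L -> R) := forall eta,
  \sum_eta' d eta' * rate alpha beta eta' eta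
  = d eta * \sum_eta' rate alpha beta eta eta'.

(** Pairing the balance equations with [f] and exchanging the sums moves the generator from the
    measure onto the observable. *)
Lemma balanced_generator (d f : config L -> R) : balanced d ->
  \sum_eta d eta *
    (\sum_(i < L) bond_rate i * (eta i)%:R * (f (hop i eta) - f eta)
     + alpha * \sum_(i < L | i == 0 :> nat) (f (flip i eta) - f eta)) = 0.
Proof.
move=> bd.
have E eta : \sum_(i < L) bond_rate i * (eta i)%:R * (f (hop i eta) - f eta)
     + alpha * \sum_(i < L | i == 0 :> nat) (f (flip i eta) - f eta)
   = \sum_eta' rate alpha beta eta eta' * f eta'
     - (\sum_eta' rate alpha beta eta eta') * f eta.
  rewrite sum_rate.
  have := sum_rate (fun=> 1) eta.
  under eq_bigr do rewrite mulr1; move=> ->.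
  under eq_bigr do rewrite mulrBr.
  rewrite [X in X + _]sumrB [X in _ + alpha * X]sumrB.
  under [X in _ = _ - (X + _) * _]eq_bigr do rewrite mulr1.
  rewrite mulrDl -mulrA !mulr_suml mulrBr.
  under [X in _ = _ - (_ + alpha * X)]eq_bigr do rewrite mul1r.
  ring.
under eq_bigr do rewrite E mulrBr mulr_sumr.
rewrite sumrB exchange_big /=; apply/eqP; rewrite subr_eq0; apply/eqP.
apply: eq_bigr => eta _.
by rewrite mulrA -bd mulr_suml; apply: eq_bigr => eta' _; rewrite mulrA.
Qed.

(** * Spin products and duality *)

Definition walsh s eta : R := \prod_(k < L) (-1) ^+ (s k && eta k).

Definition toggle (i : nat) s : nat -> bool := fun k => s k (+) (k == i).

(** Marks the bonds where a block of [s] begins or ends. Sets are predicates on [nat] so that the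
    bond at the last site is covered too, with [s L = false] imposed there. *)
Definition edge s (i : nat) : bool := s i (+) s i.+1.

Lemma walsh_hop s eta (i : 'I_L) : s L = false ->
  walsh s (hop i eta) = (-1) ^+ edge s i * walsh s eta.
Proof.
move=> sL; rewrite /walsh /edge.
have E (k : 'I_L) : ((-1) ^+ (s k && hop i eta k) : R) =
    ((-1) ^+ (s k && (k == i :> nat)) * (-1) ^+ (s k && (k == i.+1 :> nat)))
    * (-1) ^+ (s k && eta k).
  rewrite ffunE -!signr_addb; congr (_ ^+ _).
  (* The two sites are distinct, so the disjunction in [hop] acts as an exclusive or. *)
  have : ~~ ((k == i :> nat) && (k == i.+1 :> nat)) by lia.
  by case: (s k); case: (_ == _); case: (_ == _); case: (eta k).
under eq_bigr do rewrite E.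
rewrite !big_split /=; congr (_ * _); rewrite signr_addb; congr (_ * _).
  rewrite (bigD1 i) //= eqxx andbT big1 ?mulr1 // => k ki.
  by rewrite val_eqE (negbTE ki) andbF.
have [iL|iL] := boolP (i.+1 < L)%N.
  rewrite (bigD1 (Ordinal iL)) //= eqxx andbT big1 ?mulr1 // => k ki.
  by rewrite -[k == i.+1 :> nat]/(k == Ordinal iL) (negbTE ki) andbF.
have iL' : i.+1 = L by have := ltn_ord i; lia.
rewrite iL' sL big1 // => k _.
by rewrite (ltn_eqF (ltn_ord k)) andbF.
Qed.

Lemma walsh_flip s eta (i : 'I_L) :
  walsh s (flip i eta) = (-1) ^+ s i * walsh s eta.
Proof.
rewrite /walsh (bigD1 i) //= [in RHS](bigD1 i) //= mulrA; congr (_ * _).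
  by rewrite ffunE eqxx -signr_addb; case: (s i); case: (eta i).
by apply: eq_bigr => k /negbTE ki; rewrite ffunE ki.
Qed.

Lemma walsh_toggle s eta (i : 'I_L) :
  walsh (toggle i s) eta = (-1) ^+ eta i * walsh s eta.
Proof.
rewrite /walsh (bigD1 i) //= [in RHS](bigD1 i) //= mulrA; congr (_ * _).
  by rewrite /toggle eqxx -signr_addb; case: (s i); case: (eta i).
by apply: eq_bigr => k ki; rewrite /toggle val_eqE (negbTE ki) addbF.
Qed.

Lemma eq_walsh s1 s2 eta : (forall k, (k < L)%N -> s1 k = s2 k) ->
  walsh s1 eta = walsh s2 eta.
Proof. by move=> s12; apply: eq_bigr => k _; rewrite s12. Qed.

Lemma walsh0 s eta : (forall k, (k < L)%N -> s k = false) -> walsh s eta = 1.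
Proof. by move=> s0; rewrite /walsh big1 // => k _; rewrite s0. Qed.

Definition walsh_mean (d : config L -> R) s : R := \sum_eta d eta * walsh s eta.

(* Duality: the endpoints of the blocks of [s] jump to the left, each at the
   rate of the bond it sits on, and a block starting at the first site is
   killed at rate [2 * alpha]. *)
Lemma walsh_mean_duality (d : config L -> R) s : balanced d -> s L = false ->
  (\sum_(i < L) bond_rate i * (edge s i)%:R
    + 2 * alpha * \sum_(i < L | i == 0 :> nat) (s i)%:R) * walsh_mean d s
  = \sum_(i < L) bond_rate i * (edge s i)%:R * walsh_mean d (toggle i s).
Proof.
move=> bd sL; have := balanced_generator (walsh s) bd.
have E eta : \sum_(i < L) bond_rate i * (eta i)%:R *
      (walsh s (hop i eta) - walsh s eta)
    + alpha * \sum_(i < L | i == 0 :> nat) (walsh s (flip i eta) - walsh s eta)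
  = \sum_(i < L) bond_rate i * (edge s i)%:R * walsh (toggle i s) eta
   - (\sum_(i < L) bond_rate i * (edge s i)%:R
    + 2 * alpha * \sum_(i < L | i == 0 :> nat) (s i)%:R) * walsh s eta.
  rewrite mulrDl opprD addrA mulr_suml -sumrB; congr (_ + _).
    (* At an edge the hop reverses the sign of [walsh s]; weighted by [eta i] the change is
       [((-1) ^ eta_i - 1) * walsh s], the difference of the spin products of [toggle i s] and
       [s]. *)
    apply: eq_bigr => i _; rewrite walsh_hop // walsh_toggle.
    by case: (eta i); case: (edge s i); rewrite /=; ring.
  rewrite [2 * alpha]mulrC -!mulrA -mulrN; congr (_ * _).
  rewrite mulr_suml mulr_sumr -sumrN; apply: eq_bigr => i _.
  by rewrite walsh_flip; case: (s i) => /=; ring.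
under eq_bigr do rewrite E mulrBr mulr_sumr.
rewrite sumrB exchange_big /= => /eqP; rewrite subr_eq0 => /eqP H.
apply/esym; rewrite /walsh_mean; under eq_bigr do rewrite mulr_sumr.
rewrite mulr_sumr.
under eq_bigr do under eq_bigr do rewrite mulrCA.
by rewrite H; apply: eq_bigr => eta _; rewrite mulrCA.
Qed.

(** Termination measure of the dual recursion; bonds are counted from [1] so that an edge on the
    first bond has positive weight. *)
Definition edge_weight s : nat := \sum_(i < L) i.+1 * edge s i.

(** Toggling [i] removes its edge and flips the status of bond [i.-1], so at worst weight [i.+1] is
    traded for weight [i]; at [i = 0] there is no such bond. *)
Lemma edge_weight_toggle s (i : 'I_L) : edge s i ->
  (edge_weight (toggle i s) < edge_weight s)%N.
Proof.
move=> esi; rewrite /edge_weight (bigD1 i) //= [X in (_ < X)%N](bigD1 i) //=.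
have -> : edge (toggle i s) i = false.
  move: esi; rewrite /edge /toggle eqxx (gtn_eqF (ltnSn i)).
  by case: (s i); case: (s i.+1).
rewrite esi muln0 muln1 add0n.
have E (k : nat) : k != i -> k.+1 != i -> edge (toggle i s) k = edge s k.
  by move=> /negbTE ki /negbTE kSi; rewrite /edge /toggle ki kSi !addbF.
have [i0|i0] := posnP (i : nat).
  rewrite (eq_bigr (fun k : 'I_L => (k.+1 * edge s k)%N)) => [|k ki].
    by rewrite i0; lia.
  by rewrite E // i0.
have jL : (i.-1 < L)%N by have := ltn_ord i; lia.
have ji : Ordinal jL != i by rewrite -val_eqE /=; lia.
rewrite (bigD1 (Ordinal jL)) //= [X in (_ < _ + X)%N](bigD1 (Ordinal jL)) //=.
rewrite (eq_bigr (fun k : 'I_L => (k.+1 * edge s k)%N)) => [|k /andP[ki kj]].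
  case: (edge _ _); case: (edge _ _); lia.
by rewrite E //; move: kj; rewrite -val_eqE /=; lia.
Qed.

Lemma edge_exists s : s L = false -> (exists2 k, (k < L)%N & s k) ->
  exists i : 'I_L, edge s i.
Proof.
move=> sL [k kL sk]; apply/existsP; apply: contraTT sk => /existsPn noedge.
suff H n : (n <= L)%N -> s (L - n)%N = false.
  by rewrite -(subKn (ltnW kL)) H ?leq_subr.
elim: n => [_|n IHn nL]; first by rewrite subn0.
have nL' : (L - n.+1 < L)%N by lia.
have := noedge (Ordinal nL'); rewrite /edge /= -subSn // subSS IHn ?(ltnW nL) //.
by rewrite addbF => /negbTE.
Qed.

(** Completeness of the spin products: the sum over subsets factors over the sites, and a site where
    the configurations differ gives the factor [1 - 1]. *)
Lemma sum_walsh eta eta0 :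
  \sum_(f : config L) (\prod_(k < L) ((-1) ^+ (f k && eta k) *
     (-1) ^+ (f k && eta0 k))) = 2 ^+ L * (eta == eta0)%:R :> R.
Proof.
rewrite -(bigA_distr_bigA (fun k (b : bool) =>
  (-1) ^+ (b && eta k) * (-1) ^+ (b && eta0 k) : R)) /=.
under eq_bigr do rewrite big_bool /= !mulr1.
have [->|ne] := eqVneq eta eta0.
  transitivity (\prod_(k < L) (2 : R)); last by rewrite prodr_const card_ord mulr1.
  by apply: eq_bigr => k _; rewrite -signr_addb addbb.
rewrite mulr0; move: ne => /eqP/ffunP/existsNP[k /eqP nk].
rewrite (bigD1 k) //=.
by move: nk; case: (eta k); case: (eta0 k); rewrite //= => _; ring.
Qed.

Lemma walsh_mean_eq0 (d : config L -> R) :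
  (forall s, s L = false -> walsh_mean d s = 0) -> forall eta, d eta = 0.
Proof.
move=> d0 eta0.
pose ext (f : config L) (k : nat) := oapp f false (insub k).
have extE f (k : 'I_L) : ext f k = f k by rewrite /ext valK.
have : \sum_(f : config L) walsh_mean d (ext f) * walsh (ext f) eta0 = 0.
  apply: big1 => f _; rewrite d0 ?mul0r // /ext insubF ?ltnn //.
rewrite /walsh_mean.
under eq_bigr do rewrite mulr_suml.
rewrite exchange_big /=.
under eq_bigr => eta _.
  under eq_bigr => f _.
    rewrite -mulrA /walsh -big_split /=.
    under eq_bigr do rewrite extE.
    over.
  rewrite -mulr_sumr sum_walsh mulrCA [d eta * _]mulrC.
  over.
rewrite -mulr_sumr sum_delta => /eqP.
by rewrite mulf_eq0 expf_eq0 pnatr_eq0 andbF /= => /eqP.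
Qed.

(** * Existence and uniqueness of the stationary law *)

Hypotheses (alpha_gt0 : 0 < alpha) (beta_gt0 : 0 < beta).

Lemma bond_rate_gt0 i : 0 < bond_rate i.
Proof. by rewrite /bond_rate; case: ifP. Qed.

(** Induction on [edge_weight]: the empty set yields the total mass; for a nonempty set the right
    side of the duality is zero, while some edge makes the coefficient on the left positive. *)
Lemma balanced_mass0 (d : config L -> R) : balanced d -> \sum_eta d eta = 0 ->
  forall eta, d eta = 0.
Proof.
move=> bd d0; apply: walsh_mean_eq0 => s.
have [n] := ubnP (edge_weight s); elim: n s => // n IHn s sn sL.
have [/existsP[k sk]|/existsPn s0] := boolP [exists k : 'I_L, s k]; last first.
  rewrite /walsh_mean -[RHS]d0; apply: eq_bigr => eta _.
  by rewrite walsh0 ?mulr1 // => k kL; apply/negbTE/(s0 (Ordinal kL)).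
have := walsh_mean_duality bd sL.
rewrite [RHS]big1 => [/eqP|i _]; last first.
  have [ei|_] := boolP (edge s i); last by rewrite mulr0 mul0r.
  rewrite IHn ?mulr0 //.
    by apply: leq_trans (edge_weight_toggle ei) _.
  by rewrite /toggle sL (gtn_eqF (ltn_ord i)).
rewrite mulf_eq0 => /orP[|/eqP //].
have [i ei] : exists i : 'I_L, edge s i by apply: edge_exists => //; exists k.
rewrite gt_eqF // (bigD1 i) //= ei mulr1 -addrA ltr_pwDl ?bond_rate_gt0 //.
rewrite addr_ge0 ?mulr_ge0 ?sumr_ge0 // 1?ltW // => j _.
by rewrite mulr_ge0 // ltW // bond_rate_gt0.
Qed.

Lemma rate_ge0 eta eta' : 0 <= rate alpha beta eta eta'.
Proof.
rewrite rateE addr_ge0 ?mulr_ge0 ?sumr_ge0 // => [i _|]; last exact: ltW.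
by rewrite mulr_ge0 // ltW // bond_rate_gt0.
Qed.

Lemma balanced_lincomb (a b : R) (d e : config L -> R) :
  balanced d -> balanced e -> balanced (fun eta => a * d eta + b * e eta).
Proof.
move=> bd be eta.
rewrite [RHS]mulrDl -!mulrA -bd -be !mulr_sumr -big_split.
by apply: eq_bigr => eta' _ /=; rewrite mulrDl !mulrA.
Qed.

(* [Q 1 = 0] makes the generator singular, hence also singular on the left. *)
Lemma balanced_neq0 :
  exists2 d : config L -> R, balanced d & exists eta, d eta != 0.
Proof.
pose N := #|{: config L}|.
pose r (i j : 'I_N) : R := rate alpha beta (enum_val i) (enum_val j).
pose Q : 'M[R]_N := \matrix_(i, j) (r i j - (i == j)%:R * \sum_k r i k).
have sumQ (F : config L -> R) : \sum_(i < N) F (enum_val i) = \sum_eta F eta.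
  by rewrite (reindex (@enum_val _ (mem {: config L}))) //;
    apply: onW_bij; exact: enum_val_bij.
have N0 : (0 < N)%N by apply/card_gt0P; exists [ffun=> false].
have detQ : \det Q = 0.
  rewrite -det_tr; apply/eqP/det0P; exists (const_mx 1).
    apply/eqP => /rowP/(_ (Ordinal N0)); rewrite !mxE => /eqP.
    by rewrite oner_eq0.
  apply/rowP => j; rewrite !mxE.
  under eq_bigr do rewrite !mxE mul1r.
  rewrite sumrB [X in _ - X](bigD1 j) //= eqxx mul1r.
  rewrite [X in _ - (_ + X)]big1 => [|i ij]; first by rewrite addr0 subrr.
  by rewrite eq_sym (negbTE ij) mul0r.
have /det0P[v v0 vQ] : \det Q == 0 by rewrite detQ.
exists (fun eta => v 0 (enum_rank eta)) => [eta|].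
  move/rowP/(_ (enum_rank eta)): vQ; rewrite !mxE.
  under eq_bigr do rewrite mxE mulrBr.
  rewrite sumrB [X in _ - X](bigD1 (enum_rank eta)) //= eqxx mul1r.
  rewrite [X in _ - (_ + X)]big1 => [|i /negbTE ->]; last first.
    by rewrite mul0r mulr0.
  move/eqP; rewrite addr0 subr_eq0 /r enum_rankK => /eqP.
  rewrite (sumQ (fun e => rate alpha beta eta e)) => <-.
  rewrite -(sumQ (fun e => v 0 (enum_rank e) * rate alpha beta e eta)).
  by apply: eq_bigr => i _; rewrite enum_valK.
move/rV0Pn: v0 => [i vi]; exists (enum_val i); by rewrite enum_valK.
Qed.

(** By the triangle inequality inflow minus outflow of [|d|] is nonnegative at each configuration;
    these defects sum to zero, hence all vanish. *)
Lemma balanced_abs (d : config L -> R) :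
  balanced d -> balanced (fun eta => `|d eta|).
Proof.
move=> bd.
pose u eta := \sum_eta' `|d eta'| * rate alpha beta eta' eta
  - `|d eta| * \sum_eta' rate alpha beta eta eta'.
have u_ge0 eta : 0 <= u eta.
  rewrite subr_ge0 -[X in _ * X]ger0_norm; last first.
    by apply: sumr_ge0 => eta' _; apply: rate_ge0.
  rewrite -normrM -bd (le_trans (ler_norm_sum _ _ _)) //.
  by apply: ler_sum => eta' _; rewrite normrM [`|rate _ _ _ _|]ger0_norm // rate_ge0.
have sumu : \sum_eta u eta = 0.
  rewrite sumrB exchange_big /=; apply/eqP; rewrite subr_eq0; apply/eqP.
  by apply: eq_bigr => eta _; rewrite mulr_sumr.
move=> eta; apply/eqP; rewrite -subr_eq0; apply/eqP.
have /eqP := sumu; rewrite psumr_eq0 // => /allP/(_ eta).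
by rewrite mem_index_enum => /(_ isT)/eqP.
Qed.

Lemma balanced_unique (d e : config L -> R) : balanced d -> balanced e ->
  \sum_eta d eta = 1 -> \sum_eta e eta = 1 -> d =1 e.
Proof.
move=> bd be d1 e1 eta.
have := balanced_mass0 (balanced_lincomb 1 (-1) bd be).
rewrite big_split /= -!mulr_sumr d1 e1 => /(_ _ eta) H.
by apply/eqP; rewrite -subr_eq0 -[X in X - _]mul1r -mulN1r H //; ring.
Qed.

Lemma stationary_exists_unique :
  exists! p : {ffun config L -> R}, stationary alpha beta p.
Proof.
have [d bd [eta0 d0]] := balanced_neq0.
have bad := balanced_abs bd.
pose M := \sum_eta `|d eta|.
have M0 : M != 0.
  apply: contra_neq d0 => M0; apply/normr0_eq0.
  by rewrite (balanced_mass0 bad M0).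
have bp := balanced_lincomb M^-1 0 bad bad.
pose p : {ffun config L -> R} := [ffun eta => M^-1 * `|d eta| + 0 * `|d eta|].
have pE eta : p eta = M^-1 * `|d eta| by rewrite ffunE mul0r addr0.
have p1 : \sum_eta p eta = 1.
  by under eq_bigr do rewrite pE; rewrite -mulr_sumr mulVf.
have bp' : balanced p.
  move=> eta; rewrite !ffunE -bp; apply: eq_bigr => eta' _.
  by rewrite ffunE.
exists p; split=> [|p' [_ p'1 bp'']].
  split=> // eta; rewrite pE mulr_ge0 ?invr_ge0 ?sumr_ge0 //.
by apply/ffunP; apply: balanced_unique.
Qed.

End Chain.

(** * The two-point recurrence *)

Section Recurrence.
Variables (R : realType) (q : R).
Implicit Types (n N x y p : nat).

(* [binom_tail n x] is the probability that n fair coins show at least x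
   heads. *)
Fixpoint binom_tail n x : R :=
  match n, x with
  | _, 0 => 1
  | 0, _.+1 => 0
  | n'.+1, x'.+1 => (binom_tail n' x' + binom_tail n' x'.+1) / 2
  end.

Arguments binom_tail (n x)%_N.

Lemma binom_tail0 n : binom_tail n 0 = 1. Proof. by case: n. Qed.

Lemma binom_tail_eq0 n x : (n < x)%N -> binom_tail n x = 0.
Proof.
elim: n x => [|n IHn] [|x] // nx.
by rewrite /= !IHn ?addr0 ?mul0r //; lia.
Qed.

Lemma binom_tailB n x : binom_tail n x - binom_tail n x.+1 = 'C(n, x)%:R / 2 ^+ n.
Proof.
elim: n x => [|n IHn] [|x]; rewrite /= ?subr0 ?bin0 ?divr1 ?bin0n ?mul0r //.
  have := IHn 0; rewrite bin0 binom_tail0 exprS invfM => H.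
  by rewrite mulrA mulrAC -H; field.
transitivity (2^-1 * ('C(n, x.+1)%:R / 2 ^+ n + 'C(n, x)%:R / 2 ^+ n) : R).
  by rewrite -!IHn; field.
by rewrite binS natrD exprS invfM; ring.
Qed.

(** Unfolds to the sum of [q ^ i * binom_tail (N - 1 - i) x] over [i < N]. *)
Fixpoint discounted_tail N x : R :=
  if N is N'.+1 then q * discounted_tail N' x + binom_tail N' x else 0.

Arguments discounted_tail (N x)%_N.

Lemma discounted_tail0 N : (1 - q) * discounted_tail N 0 = 1 - q ^+ N.
Proof.
elim: N => [|N IHN] /=; first by rewrite mulr0 subrr.
by rewrite binom_tail0 mulrDr mulrCA IHN exprS; ring.
Qed.

Lemma discounted_tail_eq0 N x : (N <= x)%N -> discounted_tail N x = 0.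
Proof.
elim: N => // N IHN Nx /=.
by rewrite IHN ?(ltnW Nx) // binom_tail_eq0 // mulr0 addr0.
Qed.

(** The coin-toss recursion holds in every term; the term with no coin left vanishes at [x.+1]. *)
Lemma discounted_tailS N x :
  2 * discounted_tail N.+1 x.+1 = discounted_tail N x + discounted_tail N x.+1.
Proof.
elim: N => [|N IHN]; first by rewrite /= mulr0 !addr0 mulr0.
rewrite [discounted_tail N.+2 _]/= -/(discounted_tail N.+1 x.+1).
by rewrite mulrDr mulrCA IHN /=; field.
Qed.

Lemma discounted_tailB N x :
  discounted_tail N.+1 x - discounted_tail N.+1 x.+1 =
  \sum_(i < N.+1) q ^+ i * ('C(N - i, x)%:R / 2 ^+ (N - i)).
Proof.
elim: N => [|N IHN].
  by rewrite big_ord1 mul1r -binom_tailB /= !mulr0 !add0r.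
rewrite big_ord_recl expr0 mul1r subn0 -binom_tailB.
under eq_bigr do rewrite lift0 subSS exprS -mulrA.
by rewrite -mulr_sumr -IHN /=; ring.
Qed.

(* The recurrence is solved by reflection: [1 - E] extends to a function
   antisymmetric in the two endpoints. *)
Lemma block_recurrence_solution (L : nat) (E : nat -> nat -> R) :
  (forall x, E x x = 1) ->
  (forall y, (y.+1 < L)%N -> E 0%N y.+1 = q * E 0%N y) ->
  (forall x y, (x < y)%N -> (y.+1 < L)%N ->
    2 * E x.+1 y.+1 = E x y.+1 + E x.+1 y) ->
  forall x y, (x <= y)%N -> (y < L)%N ->
  E x y = 1 - (1 - q) * (discounted_tail (x + y) x - discounted_tail (x + y) y).
Proof.
move=> Exx E0 Exy x y; have [n] := ubnP (x + y).
elim: n x y => // n IHn x y xyn xy yL.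
have [->|xney] := eqVneq x y; first by rewrite Exx subrr mulr0 subr0.
case: y xyn xy yL xney => [|y] xyn xy yL xney; first by lia.
case: x xyn xy xney => [|x] xyn xy xney.
  rewrite add0n mulrBr. rewrite discounted_tail0 [discounted_tail _ y.+1]discounted_tail_eq0 //.
  rewrite E0 // IHn //; last by lia.
  rewrite add0n [(1 - q) * _]mulrBr discounted_tail0 [discounted_tail _ y]discounted_tail_eq0 //.
  by rewrite exprS; ring.
have n2 : (2 : R) != 0 by rewrite pnatr_eq0.
apply: (mulfI n2); rewrite Exy //; last by lia.
rewrite !IHn //; try by lia.
(* Both predecessors have coordinate sum [x + y + 1], so [discounted_tailS] at this one level, once
   per coordinate, combines their four tails. *)
have := discounted_tailS (x + y.+1) x; have := discounted_tailS (x + y.+1) y.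
rewrite !addSn !addnS => H1 H2.
transitivity (2 - (1 - q) * (2 * discounted_tail (x + y).+2 x.+1
  - 2 * discounted_tail (x + y).+2 y.+1)); last by ring.
by rewrite H1 H2; ring.
Qed.

(** Terms with [i > p] drop out, since then [p.*2 - i < p]. *)
Lemma block_recurrence_edge p :
  discounted_tail p.*2.+1 p - discounted_tail p.*2.+1 p.+1 =
  \sum_(0 <= i < p.+1) q ^+ i * ('C(p.*2 - i, p)%:R / 2 ^+ (p.*2 - i)).
Proof.
rewrite discounted_tailB.
rewrite -(big_mkord xpredT (fun i => q ^+ i * ('C(p.*2 - i, p)%:R / 2 ^+ (p.*2 - i)))).
rewrite (@big_cat_nat _ _ _ p.+1) //=; last by lia.
rewrite [X in _ + X]big_nat [X in _ + X]big1 ?addr0 // => i /andP[pi ip].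
by rewrite bin_small ?mul0r ?mulr0 //; lia.
Qed.

(** Substituting [i = p - j] turns the average into the closed form of the density; the prefactor
    comes from [1 - q = 2 * a * q]. *)
Lemma block_recurrence_edge_rev (a : R) p : 0 < a -> q = (1 + 2 * a)^-1 ->
  (1 - q) / 2 *
  \sum_(0 <= i < p.+1) q ^+ i * ('C(p.*2 - i, p)%:R / 2 ^+ (p.*2 - i)) =
  a / (2 ^+ (2 * p) * (1 + 2 * a) ^+ p.+1) *
  \sum_(0 <= j < p.+1) 'C(p + j, j)%:R * (1 + 2 * a) ^+ j * 2 ^+ (p - j).
Proof.
move=> a0 qE; rewrite big_nat_rev /= add0n.
have u0 : 1 + 2 * a != 0 by rewrite gt_eqF //; lra.
have -> : (1 - q) / 2 = a * q by rewrite qE; field.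
rewrite !mulr_sumr big_nat [RHS]big_nat; apply: eq_bigr => j /andP[_ jp].
have -> : (p.+1 - j.+1 = p - j)%N by [].
have -> : (p.*2 - (p - j) = p + j)%N by lia.
rewrite -(bin_sub (leq_addr j p)) addKn.
have [k ->] : exists k, p = (k + j)%N by exists (p - j)%N; rewrite subnK.
rewrite addnK qE mul2n -addnn exprVn exprS !exprD.
have t0 n : 2 ^+ n != 0 :> R by rewrite expf_eq0 pnatr_eq0 andbF.
have v0 n : (1 + 2 * a) ^+ n != 0 by rewrite expf_neq0.
by field; rewrite ?t0 ?v0 ?u0.
Qed.

End Recurrence.

(** * Central binomial coefficients *)

Section Wallis.
Variable R : realType.
Implicit Types (n : nat) (x : R).

(* The recursion is the reduction formula for the integral of [cos ^+ n]. *)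
Fixpoint cosX_primitive n x : R :=
  match n with
  | 0 => x
  | 1 => sin x
  | n'.+2 => (n'.+2)%:R^-1 *
      (cos x ^+ n'.+1 * sin x + n'.+1%:R * cosX_primitive n' x)
  end.

Lemma is_derive_cosX_primitive n x :
  is_derive x 1 (cosX_primitive n) (cos x ^+ n).
Proof.
suff : is_derive x 1 (cosX_primitive n) (cos x ^+ n) /\
       is_derive x 1 (cosX_primitive n.+1) (cos x ^+ n.+1) by case.
elim: n => [|n [IHn IHSn]].
  split; first exact: is_derive_id.
  exact: is_derive_sin.
split=> //.
have H := is_deriveZ (n.+2%:R^-1 : R) (is_deriveD (is_deriveM
  (is_deriveX n.+1 (is_derive_cos x)) (is_derive_sin x)) (is_deriveZ n.+1%:R IHn)).
have -> : cosX_primitive n.+2 = n.+2%:R^-1 \*: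
   (((@cos R) ^+ n.+1 * (@sin R)) + (n.+1%:R : R) \*: cosX_primitive n).
  by apply/funext => y /=; rewrite exprfctE.
apply: is_derive_eq H _.
have n0 : n.+2%:R != 0 :> R by rewrite pnatr_eq0.
have sin2 : sin x ^+ 2 = 1 - cos x ^+ 2 by rewrite -(cos2Dsin2 x); ring.
rewrite /GRing.scale exprfctE /=.
apply: (mulfI n0); rewrite mulVKf //.
rewrite mulrN mulrN mulrCA -expr2 sin2 !exprS.
have -> : n.+2%:R = n%:R + 2 :> R by rewrite -addn2 natrD.
have -> : n.+1%:R = n%:R + 1 :> R by rewrite -addn1 natrD.
ring.
Qed.

(** The integral of [cos ^+ n] over [[0, pi / 2]], as the primitive vanishes at [0]. *)
Definition wallis n : R := cosX_primitive n (pi / 2).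

Arguments wallis n%_N.

Lemma wallis0 : wallis 0 = pi / 2. Proof. by []. Qed.

Lemma wallis1 : wallis 1 = 1. Proof. exact: sin_pihalf. Qed.

Lemma wallisSS n : n.+2%:R * wallis n.+2 = n.+1%:R * wallis n.
Proof.
by rewrite /wallis /= cos_pihalf expr0n /= mul0r add0r mulVKf // pnatr_eq0.
Qed.

Lemma cosX_primitive0 n : cosX_primitive n 0 = 0.
Proof.
suff : cosX_primitive n 0 = 0 /\ cosX_primitive n.+1 0 = 0 by case.
elim: n => [|n [IHn IHSn]]; first by rewrite /= sin0.
by split=> //=; rewrite IHn sin0 !mulr0 addr0 mulr0.
Qed.

(** The difference of the two primitives vanishes at [0] and has derivative [cos ^ n * (1 - cos)],
    nonnegative up to [pi / 2]. *)
Lemma wallis_nincr n : wallis n.+1 <= wallis n.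
Proof.
pose f := cosX_primitive n - cosX_primitive n.+1.
have fE x : f x = cosX_primitive n x - cosX_primitive n.+1 x by [].
have df x : is_derive x 1 f (cos x ^+ n - cos x ^+ n.+1).
  by apply: is_deriveB; exact: is_derive_cosX_primitive.
have cf : continuous f.
  by move=> x; apply/differentiable_continuous/derivable1_diffP; exact: ex_derive.
have : f 0 <= f (pi / 2).
  apply: (@ger0_derive1_le_cc R f 0 (pi / 2)) => //.
  - move=> x; rewrite in_itv /= => /andP[x0 xpi].
    rewrite derive1E; have [_ ->] := df x.
    rewrite exprS -[X in X - _]mul1r -mulrBl mulr_ge0 ?subr_ge0 ?cos_le1 //.
    by have := pi_ge0 R; rewrite exprn_ge0 // cos_ge0_pihalf //; lra.
  - by apply: continuous_subspaceT.
  - by rewrite in_itv /= lexx divr_ge0 // pi_ge0.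
  - by rewrite in_itv /= lexx divr_ge0 // pi_ge0.
  - by rewrite divr_ge0 // pi_ge0.
by rewrite !fE !cosX_primitive0 subr0 subr_ge0.
Qed.

(** The reduction formula makes the left side independent of [n]. *)
Lemma wallis_mul n : n.+1%:R * (wallis n * wallis n.+1) = pi / 2.
Proof.
elim: n => [|n IHn]; first by rewrite wallis0 wallis1 mul1r mulr1.
by rewrite mulrCA wallisSS mulrCA -IHn [wallis n.+1 * _]mulrC.
Qed.

(** For [i <= p], the probability of exactly [p] heads in [2p - i] fair tosses. *)
Definition binom_weight (p i : nat) : R :=
  'C(p.*2 - i, p)%:R / 2 ^+ (p.*2 - i).

Arguments binom_weight (p i)%_N.

Lemma wallis_even p : wallis p.*2 = pi / 2 * binom_weight p 0.
Proof.
elim: p => [|p IHp]; first by rewrite wallis0 /binom_weight bin0 divr1 mulr1.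
have p0 : p.*2.+2%:R != 0 :> R by rewrite pnatr_eq0.
apply: (mulfI p0); rewrite doubleS wallisSS IHp mulrCA [in RHS]mulrCA.
congr (_ * _); rewrite /binom_weight doubleS !subn0 !exprS.
have H : (p.+1 * 'C(p.*2.+2, p.+1) = 2 * (p.*2.+1 * 'C(p.*2, p)))%N.
  have := mul_bin_diag p.*2.+2 p; have := mul_bin_down p.*2.+1 p.
  rewrite /=; nia.
have {H} := congr1 (fun k => k%:R : R) H; rewrite !natrM => H.
have -> : p.*2.+2%:R = 2 * p.+1%:R :> R by rewrite -natrM; congr _%:R; lia.
have e0 : 2 ^+ p.*2 != 0 :> R by rewrite expf_eq0 pnatr_eq0 andbF.
transitivity (p.+1%:R * 'C(p.*2.+2, p.+1)%:R / 2 / 2 ^+ p.*2 : R).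
  by rewrite H; field.
by field.
Qed.

Lemma binom_weightS p i : (i < p)%N ->
  (p.*2 - i)%:R * binom_weight p i.+1 = (p.*2 - i.*2)%:R * binom_weight p i.
Proof.
move=> ip; rewrite /binom_weight.
have -> : (p.*2 - i = (p.*2 - i.+1).+1)%N by lia.
set N := (p.*2 - i.+1)%N.
have -> : (p.*2 - i.*2 = 2 * (N.+1 - p))%N by rewrite /N; lia.
have e0 : 2 ^+ N != 0 :> R by rewrite expf_eq0 pnatr_eq0 andbF.
have {ip} := congr1 (fun k => k%:R : R) (mul_bin_down N.+1 p).
rewrite /= !natrM mulrA => ->.
by rewrite exprS; field.
Qed.

Lemma binom_weight_ge0 p i : 0 <= binom_weight p i.
Proof. by rewrite /binom_weight divr_ge0 // exprn_ge0. Qed.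

Lemma binom_weight0_gt0 p : 0 < binom_weight p 0.
Proof.
rewrite /binom_weight divr_gt0 ?exprn_gt0 // ltr0n bin_gt0; lia.
Qed.

(** Step [i] loses the fraction [i / (2p - i) <= i / p] of the weight, and
    [0 + 1 + ... + (i - 1) <= i ^ 2]. *)
Lemma binom_weight_bounds p i : (i <= p)%N ->
  binom_weight p i <= binom_weight p 0 /\
  (p%:R - i%:R ^+ 2) * binom_weight p 0 <= p%:R * binom_weight p i.
Proof.
elim: i => [|i IHi] ip; first by rewrite expr0n subr0.
have [ub lb] := IHi (ltnW ip).
have := binom_weightS ip.
rewrite natrB; last by lia.
rewrite natrB; last by lia.
have i0 : 0 <= i%:R :> R by [].
have iN : i%:R + 1 <= p%:R :> R by rewrite natr1 ler_nat.
rewrite -!muln2 !natrM -(natr1 i).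
move: ub lb i0 iN (binom_weight_ge0 p i) (binom_weight0_gt0 p).
move: (binom_weight p i) (binom_weight p i.+1) (binom_weight p 0) => a b a0.
move: (i%:R) (p%:R) => {ip IHi}i {}p ub lb i0 ip age0 a0gt0 H.
have N0 : 0 < p * 2 - i by lra.
have Hb : (p * 2 - i) * (a - b) = i * a by lra.
have ba : b <= a.
  by rewrite -subr_ge0 -(pmulr_rge0 _ N0) Hb mulr_ge0.
split; first exact: le_trans ba ub.
have H1 : p * (a - b) <= i * a.
  by rewrite -Hb ler_wpM2r ?subr_ge0 //; lra.
have H2 : i * a <= i * a0 by rewrite ler_wpM2l.
have H3 : 0 <= i * a0 by rewrite mulr_ge0 // ltW.
nra.
Qed.

(* The Wallis product, in the form of the two-sided bound
   [W_(2p) W_(2p+1) <= W_(2p) ^ 2 <= W_(2p) W_(2p-1)]. *)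
Lemma binom_weight_wallis p :
  1 <= pi * p.+1%:R * binom_weight p 0 ^+ 2 /\
  p%:R * (pi * p.+1%:R * binom_weight p 0 ^+ 2) <= p.+1%:R.
Proof.
have pi0 := pi_gt0 R.
have W := wallis_even p; have w0 := binom_weight0_gt0 p.
have W0 : 0 < wallis p.*2 by rewrite W mulr_gt0 // divr_gt0.
have p0 : 0 <= p%:R :> R by [].
have pS : p.+1%:R = p%:R + 1 :> R by rewrite natr1.
split.
  move: (binom_weight p 0) W w0 => b W w0.
  have := wallis_mul p.*2.
  have : wallis p.*2 * wallis p.*2.+1 <= wallis p.*2 ^+ 2.
    by rewrite expr2 ler_pM2l // wallis_nincr.
  have -> : p.*2.+1%:R = p%:R * 2 + 1 :> R by rewrite -natr1 -muln2 natrM.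
  rewrite W pS; move: (wallis p.*2.+1) => w1 H1 H2.
  have : pi / 2 <= (p%:R * 2 + 1) * (pi / 2 * b) ^+ 2.
    by rewrite -[leLHS]H2 ler_wpM2l //; lra.
  rewrite exprMn -!mulrA => H3.
  have : pi / 2 * 1 <= pi / 2 * ((p%:R * 2 + 1) * (pi / 2) * b ^+ 2).
    by rewrite mulr1 (le_trans H3) // expr2 le_eqVlt; apply/orP; left; apply/eqP; ring.
  rewrite ler_pM2l ?divr_gt0 // => H4; apply: le_trans H4 _.
  rewrite !mulrA !ler_wpM2r ?(ltW w0) //.
  have := mulr_ge0 p0 (ltW pi0). lra.
(* [W_(2p-1)] makes no sense at [p = 0], where the factor [p] trivializes the bound. *)
case: p {p0} W w0 W0 pS => [|p] W w0 W0 pS; first by rewrite mul0r.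
move: (binom_weight p.+1 0) W w0 => b W w0.
have := wallis_mul p.*2.+1.
have : wallis p.+1.*2 ^+ 2 <= wallis p.*2.+1 * wallis p.*2.+2.
  by rewrite doubleS expr2 ler_pM2r -?doubleS // doubleS wallis_nincr.
have -> : p.*2.+2%:R = p.+1%:R * 2 :> R by rewrite -muln2 -natrM; congr _%:R; lia.
rewrite [X in X ^+ 2]W; move: (wallis p.*2.+1 * _) => w1 H1 H2.
have P0 : 0 < p.+1%:R :> R by [].
have : p.+1%:R * 2 * (pi / 2 * b) ^+ 2 <= pi / 2.
  by rewrite -[leRHS]H2 ler_wpM2l //; lra.
have -> : p.+1%:R * 2 * (pi / 2 * b) ^+ 2 =
  pi / 2 * (p.+1%:R * pi * b ^+ 2) by field.
rewrite -[leRHS]mulr1 ler_pM2l ?divr_gt0 // => H3.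
rewrite -[leRHS]mulr1.
have -> : p.+1%:R * (pi * p.+2%:R * b ^+ 2) =
  p.+2%:R * (p.+1%:R * pi * b ^+ 2) by ring.
by rewrite ler_wpM2l.
Qed.

End Wallis.

(** * Geometric averages *)

Section Asymptotics.
Variables (R : realType) (q : R).
Hypotheses (q_gt0 : 0 < q) (q_lt1 : q < 1).

Definition geom_average (p : nat) : R :=
  (1 - q) * \sum_(0 <= i < p.+1) q ^+ i * binom_weight R p i.

Lemma geom_sum n : (1 - q) * \sum_(0 <= i < n) q ^+ i = 1 - q ^+ n.
Proof.
elim: n => [|n IHn]; first by rewrite big_nil mulr0 subrr.
by rewrite big_nat_recr //= mulrDr IHn exprS; ring.
Qed.

(** Upper bound for the second moment of the geometric law, whose exact value is
    [q (1 + q) / (1 - q) ^ 2]. *)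
Definition geom_moment : R := 2 / (1 - q) ^+ 2.

(* Summation by parts: for [g i = i ^ 2 + 2 i / (1 - q) + 2 / (1 - q) ^ 2] one has
   [(1 - q) i ^ 2 q ^ i <= g i q ^ i - g (i+1) q ^ (i+1)], which telescopes. *)
Lemma geom_square_sum n :
  (1 - q) * \sum_(0 <= i < n) q ^+ i * i%:R ^+ 2 <= geom_moment.
Proof.
have q1 : 0 < 1 - q by rewrite subr_gt0.
pose g (x : R) := x ^+ 2 + 2 * x / (1 - q) + geom_moment.
suff : (1 - q) * (\sum_(0 <= i < n) q ^+ i * i%:R ^+ 2) <= geom_moment - q ^+ n * g n%:R.
  move=> /le_trans; apply; rewrite lerBlDr lerDl mulr_ge0 //.
    by rewrite exprn_ge0 // ltW.
  have q1' := ltW q1.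
  by rewrite /g /geom_moment !addr_ge0 ?mulr_ge0 ?invr_ge0 ?exprn_ge0.
elim: n => [|n IHn].
  by rewrite big_nil mulr0 /g expr0n /= !mulr0 mul0r !add0r mul1r subrr.
rewrite big_nat_recr //= mulrDr.
have : (1 - q) * n%:R ^+ 2 <= g n%:R - q * g n.+1%:R.
  rewrite -natr1 /g /geom_moment; move: n%:R (ler0n R n) => x x0.
  rewrite -subr_ge0.
  have -> : x ^+ 2 + 2 * x / (1 - q) + 2 / (1 - q) ^+ 2
    - q * ((x + 1) ^+ 2 + 2 * (x + 1) / (1 - q) + 2 / (1 - q) ^+ 2)
    - (1 - q) * x ^+ 2 = 2 * (1 - q) * x + (2 - q).
    by field; rewrite gt_eqF.
  rewrite addr_ge0 //; last by lra.
  by rewrite !mulr_ge0 //; lra.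
have qn : 0 <= q ^+ n by rewrite exprn_ge0 // ltW.
move=> /(ler_wpM2l qn) H; move: IHn; rewrite [q ^+ n.+1]exprSr.
move: H; move: (g n%:R) (g n.+1%:R) (q ^+ n) (\sum_(0 <= i < n) _) => a b r S H IH.
clear -H IH; lra.
Qed.

(** Averaging [binom_weight_bounds]: [geom_moment] pays for the squares [i ^ 2], and [p * q ^ (p+1)]
    for the mass [q ^ (p+1)] that the truncated weights lack. *)
Lemma geom_average_bounds p :
  geom_average p <= binom_weight R p 0 /\
  (p%:R - geom_moment - p%:R * q ^+ p.+1) * binom_weight R p 0
    <= p%:R * geom_average p.
Proof.
have q1 : 0 < 1 - q by rewrite subr_gt0.
have qi i : 0 <= q ^+ i by rewrite exprn_ge0 // ltW.
have w0 := ltW (binom_weight0_gt0 R p).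
split.
  apply: (@le_trans _ _ ((1 - q ^+ p.+1) * binom_weight R p 0)).
    rewrite -geom_sum -mulrA ler_wpM2l ?(ltW q1) // mulr_suml big_nat [leRHS]big_nat.
    apply: ler_sum => i /andP[_ ip]; rewrite ler_wpM2l //.
    by have [] := @binom_weight_bounds R p i ip.
  by rewrite ler_piMl // lerBlDr lerDl.
apply: (@le_trans _ _ ((1 - q) * \sum_(0 <= i < p.+1)
   q ^+ i * ((p%:R - i%:R ^+ 2) * binom_weight R p 0))).
  under eq_bigr do rewrite mulrA mulrBr [_ * p%:R]mulrC.
  rewrite -mulr_suml [leRHS]mulrA sumrB -mulr_sumr ler_wpM2r //.
  rewrite mulrBr mulrCA geom_sum.
  have := geom_square_sum p.+1.
  lra.
rewrite /geom_average [leRHS]mulrCA ler_wpM2l ?(ltW q1) // mulr_sumr big_nat [leRHS]big_nat.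
apply: ler_sum => i /andP[_ ip]; rewrite [leRHS]mulrCA ler_wpM2l //.
by have [] := @binom_weight_bounds R p i ip.
Qed.

Lemma geom_average_equiv :
  geom_average p * Num.sqrt (pi * p.+1%:R) @[p --> \oo] --> (1 : R).
Proof.
(* [lo] is the lower bound of [geom_average_bounds] divided by [p]; [up] is the Wallis upper bound
   on the squared normalized central weight [z ^+ 2], hence on [z], as [1 <= z]. *)
pose lo (p : nat) : R := 1 - geom_moment / p%:R - q ^+ p.+1.
pose up (p : nat) : R := 1 + p%:R^-1.
have pi0 := pi_gt0 R.
have inv0 : (p%:R^-1 : R) @[p --> \oo] --> (0 : R).
  rewrite -(cvg_shiftS (fun p : nat => (p%:R^-1 : R))).
  exact: cvg_harmonic.
apply: (@squeeze_cvgr _ _ _ _ lo up).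
- exists 1%N => // p /= p0.
  have P0 : 0 < p%:R :> R by rewrite ltr0n.
  have [ub lb] := geom_average_bounds p.
  have [wl wu] := binom_weight_wallis R p.
  have w0 := binom_weight0_gt0 R p.
  have := sqr_sqrtr (_ : 0 <= pi * p.+1%:R :> R).
  rewrite mulr_ge0 ?(ltW pi0) // => /(_ isT).
  have := sqrtr_ge0 (pi * p.+1%:R : R).
  move: (Num.sqrt _) => s s0 sE.
  move: wl wu; rewrite -sE -exprMn.
  set z := s * _ => z1 z2.
  have z0 : 0 <= z by rewrite mulr_ge0 // ltW.
  have z1' : 1 <= z by rewrite -(@ler_pXn2r _ 2) ?expr1n ?nnegrE.
  have z2' : z <= up p.
    apply: (le_trans (_ : z <= z ^+ 2)); first by rewrite expr2 ler_peMl.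
    by rewrite /up -(ler_pM2l P0) mulrDr mulr1 mulfV ?gt_eqF // natr1.
  apply/andP; split; last first.
    by apply: le_trans z2'; rewrite mulrC /z ler_wpM2l.
  have lo1 : lo p * binom_weight R p 0 <= geom_average p.
    rewrite -(ler_pM2l P0) (le_trans _ lb) // mulrA.
    rewrite le_eqVlt; apply/orP; left; apply/eqP; congr (_ * _).
    by rewrite /lo; field; rewrite gt_eqF.
  have [l0|l0] := leP 0 (lo p).
    apply: (le_trans (_ : _ <= lo p * z)); first by rewrite ler_peMr.
    by rewrite /z mulrCA [leRHS]mulrC ler_wpM2l.
  (* A negative [lo p] lies below the product because the latter is nonnegative. *)
  apply: (le_trans (ltW l0)); rewrite mulr_ge0 //.
  rewrite /geom_average mulr_ge0 ?sumr_ge0 //; first by rewrite subr_ge0 ltW.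
  by move=> i _; rewrite mulr_ge0 ?binom_weight_ge0 // exprn_ge0 // ltW.
- have -> : (1 : R) = 1 - geom_moment * 0 - 0 by rewrite mulr0 !subr0.
  apply: cvgB.
    apply: cvgB; first exact: cvg_cst.
    by apply: cvgM; [exact: cvg_cst|].
  rewrite (cvg_shiftS (fun p : nat => q ^+ p)).
  by apply: cvg_expr; rewrite ger0_norm // ltW.
- rewrite -[X in _ --> X]addr0.
  by apply: cvgD; [exact: cvg_cst|].
Qed.

End Asymptotics.

(** * The density *)

Section Density.
Variables (R : realType) (alpha beta : R) (L : nat).
Hypothesis alpha_gt0 : 0 < alpha.

(** Indices start at [0]: these are the sites labelled [x + 1] to [y]. *)
Definition block (x y k : nat) : bool := (x <= k < y)%N.

Lemma block_out x y k : (y <= k)%N -> block x y k = false.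
Proof. rewrite /block; lia. Qed.

Lemma sum_ord_delta (F : nat -> R) x : (x < L)%N ->
  \sum_(i < L) (i == x :> nat)%:R * F i = F x.
Proof.
move=> xL; rewrite (bigD1 (Ordinal xL)) //= eqxx mul1r big1 ?addr0 // => i.
by rewrite -val_eqE /= => /negbTE ->; rewrite mul0r.
Qed.

Variable d : config L -> R.
Hypotheses (d_balanced : balanced alpha beta d) (d1 : \sum_eta d eta = 1).

Definition block_mean x y := walsh_mean d (block x y).

Lemma block_mean_toggle x y x' y' (i : nat) :
  (forall k, (k < L)%N -> toggle i (block x y) k = block x' y' k) ->
  walsh_mean d (toggle i (block x y)) = block_mean x' y'.
Proof.
by move=> H; apply: eq_bigr => eta _; congr (_ * _); apply: eq_walsh.
Qed.

Lemma block_mean_empty x : block_mean x x = 1.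
Proof.
rewrite -d1; apply: eq_bigr => eta _; rewrite walsh0 ?mulr1 // => k _.
by rewrite /block; lia.
Qed.

(** The only edge is at the right end, on a bond of rate [1]; killing at the first site adds
    [2 * alpha] to the total rate. *)
Lemma block_mean_left y : (y.+1 < L)%N ->
  (1 + 2 * alpha) * block_mean 0 y.+1 = block_mean 0 y.
Proof.
move=> yL; have yL' := ltnW yL.
have := @walsh_mean_duality R alpha beta L d (block 0 y.+1) d_balanced.
have edgeE i : edge (block 0 y.+1) i = (i == y) by rewrite /edge /block; lia.
move=> /(_ (block_out _ (ltnW yL))).
under eq_bigr do rewrite edgeE mulrC.
rewrite sum_ord_delta //.
under [X in _ = X -> _]eq_bigr do rewrite edgeE -mulrA mulrCA.
rewrite (sum_ord_delta (fun i => bond_rate beta L i *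
  walsh_mean d (toggle i (block 0 y.+1)))) //.
have L0 : (0 < L)%N by lia.
rewrite (big_pred1 (Ordinal L0)) // /bond_rate (ltn_eqF yL) mulr1 mul1r => ->.
apply: block_mean_toggle => k _; rewrite /toggle /block; lia.
Qed.

(** Both endpoints sit on bonds of rate [1], and a block off the first site is not killed. As
    [y.+1 < L], the exit bond is never reached: this is why neither [beta] nor [L] enters the
    density. *)
Lemma block_mean_bulk x y : (x < y)%N -> (y.+1 < L)%N ->
  2 * block_mean x.+1 y.+1 = block_mean x y.+1 + block_mean x.+1 y.
Proof.
move=> xy yL; have yL' := ltnW yL; have xL : (x < L)%N by lia.
have := @walsh_mean_duality R alpha beta L d (block x.+1 y.+1) d_balanced.
have edgeE i : (edge (block x.+1 y.+1) i)%:R = (i == x)%:R + (i == y)%:R :> R.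
  by rewrite -natrD; congr _%:R; rewrite /edge /block; lia.
move=> /(_ (block_out _ (ltnW yL))).
under eq_bigr do rewrite edgeE mulrC mulrDl.
rewrite big_split !sum_ord_delta //=.
under [X in _ = X -> _]eq_bigr do rewrite edgeE -mulrA mulrCA mulrDl.
rewrite big_split /= !(sum_ord_delta (fun i => bond_rate beta L i *
  walsh_mean d (toggle i (block x.+1 y.+1)))) //.
rewrite [X in _ + _ * X]big1 => [|i /eqP ->]; last by rewrite /block.
have xne : x.+1 == L = false by lia.
rewrite mulr0 addr0 /bond_rate (ltn_eqF yL) xne !mul1r => ->.
by congr (_ + _); apply: block_mean_toggle => k _; rewrite /toggle /block; lia.
Qed.

Lemma block_mean_site p : (p < L)%N ->
  \sum_eta d eta * occ R p.+1 eta = (1 - block_mean p p.+1) / 2.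
Proof.
move=> pL; rewrite -[X in X - _]d1 -sumrB mulr_suml; apply: eq_bigr => eta _.
rewrite /occ (big_pred1 (Ordinal pL)) //.
rewrite /walsh (bigD1 (Ordinal pL)) //= big1 => [|k kp]; last first.
  have -> : block p p.+1 k = false by move: kp; rewrite -val_eqE /= /block; lia.
  by [].
have -> : block p p.+1 p by rewrite /block; lia.
by rewrite mulr1 /=; case: (eta _) => /=; field.
Qed.

Lemma block_mean_density p : (p.+1 < L)%N ->
  let q := (1 + 2 * alpha)^-1 in
  \sum_eta d eta * occ R p.+1 eta = geom_average q p / 2.
Proof.
move=> pL q; rewrite block_mean_site ?(ltnW pL) //; congr (_ / _).
have a0 : 1 + 2 * alpha != 0.
  by rewrite gt_eqF // addr_gt0 // mulr_gt0.
rewrite (@block_recurrence_solution R q L block_mean) //.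
- rewrite opprB addrC subrK addnS addnn.
  by rewrite block_recurrence_edge.
- exact: block_mean_empty.
- by move=> y yL; rewrite -(block_mean_left yL) mulKf.
- exact: block_mean_bulk.
Qed.

End Density.

Theorem mainTheorem6 (R : realType) (alpha beta : R)
    (halpha : 0 < alpha) (hbeta : 0 < beta) :
  [/\ forall L : nat, (0 < L)%N ->
        exists! p : {ffun config L -> R}, stationary alpha beta p,
      forall L m : nat, (1 <= m)%N -> (m < L)%N ->
        bracket alpha beta (@occ R L m) =
        alpha / (2 ^+ (2 * (m - 1)) * (1 + 2 * alpha) ^+ m) *
        \sum_(0 <= j < m)
          ('C(m - 1 + j, j))%:R * (1 + 2 * alpha) ^+ j * 2 ^+ (m - 1 - j)
    & forall L : nat -> nat, (forall m : nat, (m < L m)%N) ->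
        bracket alpha beta (@occ R (L m) m) / (1 / (2 * Num.sqrt (pi * m%:R)))
          @[m --> \oo] --> (1 : R)].
Proof.
have exU L := stationary_exists_unique L halpha hbeta.
pose q := (1 + 2 * alpha)^-1.
have density L p : (p.+1 < L)%N ->
    bracket alpha beta (@occ R L p.+1) = geom_average q p / 2.
  move=> pL; have [law [statlaw _]] := exU L.
  have [_ law1 bal] : stationary alpha beta (stationary_law alpha beta L).
    (* [law] satisfies the predicate, so [xget] does not fall back on its default. *)
    by rewrite /stationary_law; case: xgetP => [? _ //|/(_ law)].
  exact: (block_mean_density halpha bal law1 pL).
split=> [L _||]; first exact: exU.
- move=> L [//|p] _ pL; rewrite density // subSS subn0.
  by rewrite -(@block_recurrence_edge_rev R q) // /geom_average mulrAC.
- move=> L mL.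
  have q0 : 0 < q by rewrite invr_gt0 addr_gt0 // mulr_gt0.
  have q1 : q < 1 by rewrite invf_lt1 ?ltrDl ?mulr_gt0 // addr_gt0 // mulr_gt0.
  (* Shifting to [m = p.+1] discards [m = 0], which labels no site. *)
  rewrite -(cvg_shiftS (fun m => bracket alpha beta (@occ R (L m) m)
    / (1 / (2 * Num.sqrt (pi * m%:R))))) /=.
  apply: cvg_trans (geom_average_equiv q0 q1); apply: near_eq_cvg.
  by apply: nearW => p; rewrite density // div1r invrK; field.
Qed.
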